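(* Let $\pi=(d_{\max},\ldots,d_{\max},d_{\max}-1,\ldots,d_{\max}-1,\ldots,1,\ldots,1)$ be a full graphic sequence with $n$ elements, all lying in $\{1,\ldots,d_{\max}\}$, such that $d_{\max}\leq n/4$, the sum of the elements of $\pi$ is at least $2n+d_{\max}$, and each integer $k$ with $1\leq k\leq d_{\max}$ appears more than once in $\pi$. Then $\pi$ has a connected realization $G$ such that \[ \lambda_{1}(G)\leq\frac{4}{|E(G)|-d_{\max}/2}, \] where $|E(G)|$ is the number of edges of $G$.
   Context: All graphs are finite, without loops or multiple edges. A sequence $\pi=(d_1,\ldots,d_n)$ of nonnegative integers is graphic if there is a graph with $n$ vertices whose vertex degrees are $d_1,\ldots,d_n$; such a graph is a realization of $\pi$. A sequence $\pi$ with largest element $d_{\max}$ is a full sequence if every integer $d$ with $1\leq d\leq d_{\max}$ is an element of $\pi$ and the sum of its elements is even. For a graph $G$ with adjacency matrix $A$ and diagonal degree matrix $D$, the normalized Laplacian is $L=D^{-1}A-I$; its eigenvalues are real and nonpositive, written $-\lambda_0,-\lambda_1,\ldots$ with $0=\lambda_0\leq\lambda_1\leq\cdots$, and $\lambda_1(G)$ denotes the smallest nontrivial such value (the spectral gap). *)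

(* Defs.v *)
From HB Require Import structures.
From mathcomp Require Import all_boot all_order all_algebra.
From mathcomp Require Import reals.
Set Implicit Arguments. Unset Strict Implicit. Unset Printing Implicit Defensive.
Import Order.TTheory GRing.Theory Num.Theory.

Definition simple_graph (n : nat) (e : rel 'I_n) : Prop :=
  symmetric e /\ irreflexive e.

Definition deg (n : nat) (e : rel 'I_n) (i : 'I_n) : nat := #|[set j | e i j]|.

Definition nedges (n : nat) (e : rel 'I_n) : nat :=
  #|[set p : 'I_n * 'I_n | (p.1 < p.2)%N && e p.1 p.2]|.

Definition connected_graph (n : nat) (e : rel 'I_n) : Prop :=
  forall i j : 'I_n, connect e i j.

Definition realization (pi : seq nat) (e : rel 'I_(size pi)) : Prop :=
  simple_graph e /\ forall i : 'I_(size pi), deg e i = nth 0%N pi i.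
Arguments realization : clear implicits.

Definition graphic (pi : seq nat) : Prop := exists e, realization pi e.

Definition dmax (pi : seq nat) : nat := \max_(d <- pi) d.

Definition full_seq (pi : seq nat) : Prop :=
  (forall d, (1 <= d <= dmax pi)%N -> d \in pi) /\ ~~ odd (sumn pi).

Local Open Scope ring_scope.

(* -L = I - D^{-1} A, whose eigenvalues are 0 = lambda_0 <= lambda_1 <= ... *)
Definition negLap (R : realType) (n : nat) (e : rel 'I_n) : 'M[R]_n :=
  \matrix_(i, j) ((i == j)%:R - (e i j)%:R / (deg e i)%:R).

Definition nlap_spectrum (R : realType) (n : nat) (e : rel 'I_n) (s : seq R)
  : Prop :=
  sorted <=%R s /\ char_poly (negLap R e) = \prod_(x <- s) ('X - x%:P).

Definition lambda1_le (R : realType) (n : nat) (e : rel 'I_n) (c : R) : Prop :=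
  exists s : seq R, nlap_spectrum e s /\ s`_1 <= c.

(* Main.v *)
Require Import Defs.
From HB Require Import structures.
From mathcomp Require Import all_boot zify.
Set Implicit Arguments. Unset Strict Implicit. Unset Printing Implicit Defensive.

(* Put the even positions of pi in A and the odd ones in the complement B. Since
   pi is nonincreasing and repeats every value, both halves take all the values
   1, ..., dmax, and their volumes differ by at most dmax. A degree function
   without gaps on at least 2 dmax vertices is graphic, and a 2-switch
   through a non-bridge edge joins components, so each half has a connected
   realization. Joining the two halves, by a switch when the volumes are even and
   by one edge when they are odd, creates at most 2 edges between A and B.
   On functions constant on A and on B the Rayleigh quotient is at most
   2 (vol A + vol B) / (vol A * vol B), which bounds lambda_1 by Courant-Fischer. *)

(** * Degrees, bridges and switches *)

Section Degrees.
Variable T : finType.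
Implicit Types (e : rel T) (d : T -> nat) (S : {set T}).

(** The notion [deg] over an arbitrary finite vertex type; on ['I_n] the two are convertible. *)
Definition nbdeg e (x : T) : nat := #|[set y | e x y]|.

Definition realizes d e : Prop :=
  [/\ symmetric e, irreflexive e & forall x, nbdeg e x = d x].

Definition pair_rel (u v : T) : rel T :=
  fun a b => ((a == u) && (b == v)) || ((a == v) && (b == u)).

Definition del_edge e (u v : T) : rel T := fun a b => e a b && ~~ pair_rel u v a b.

Definition switch e (u v x y : T) : rel T := fun a b =>
  [|| del_edge (del_edge e u v) x y a b, pair_rel u x a b | pair_rel v y a b].

Lemma nbdeg_sum e x : nbdeg e x = \sum_y (e x y : nat).
Proof.
rewrite /nbdeg -sum1dep_card big_mkcond /=.
by apply: eq_bigr => y _; case: (e x y).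
Qed.

Lemma pair_relC u v : symmetric (pair_rel u v).
Proof. by move=> a b; rewrite /pair_rel orbC !(andbC (a == _)). Qed.

Lemma sum_eq1 (v : T) : \sum_(y : T) ((y == v) : nat) = 1.
Proof. by rewrite (bigD1 v) //= eqxx big1 // => i /negbTE ->. Qed.

Lemma sum_pair_rel u v a : u != v ->
  \sum_b (pair_rel u v a b : nat) = (a == u) + (a == v).
Proof.
move=> uv; rewrite /pair_rel.
have [->|_] := eqVneq a u.
  by rewrite (negbTE uv) /= addn0 -(sum_eq1 v); apply: eq_bigr => b _; rewrite orbF.
have [_|_] := eqVneq a v; last by rewrite big1.
by rewrite /= add0n -(sum_eq1 u); apply: eq_bigr.
Qed.

Lemma del_edgeC e u v : symmetric e -> symmetric (del_edge e u v).
Proof. by move=> sy a b; rewrite /del_edge sy pair_relC. Qed.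

Lemma pair_rel_sub e u v a b : symmetric e -> e u v -> pair_rel u v a b -> e a b.
Proof.
by move=> sy euv /orP[] /andP[/eqP-> /eqP->] //; rewrite sy.
Qed.

Lemma nbdeg_del e u v x : symmetric e -> e u v -> u != v ->
  nbdeg e x = nbdeg (del_edge e u v) x + ((x == u) + (x == v)).
Proof.
move=> sy euv uv; rewrite !nbdeg_sum -sum_pair_rel // -big_split /=.
apply: eq_bigr => y _; rewrite /del_edge.
have := @pair_rel_sub e u v x y sy euv.
by case: (pair_rel u v x y) => [->|_] //; rewrite andbT addn0.
Qed.

(** A walk that starts in the closed set [S] never leaves it, so only the edges inside [S] have to
    be simulated by [r']. *)
Lemma connect_restrict (r r' : rel T) S x y :
    (forall a b, a \in S -> r a b -> b \in S) ->
    (forall a b, a \in S -> r a b -> connect r' a b) ->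
  x \in S -> connect r x y -> connect r' x y.
Proof.
move=> cl sub xS /connectP[p]; elim: p x xS => [|z p IH] x xS /=.
  by move=> _ ->.
case/andP=> rxz pz yE; apply: connect_trans (sub _ _ xS rxz) _.
exact: IH (cl _ _ xS rxz) pz yE.
Qed.

(* Splitting along a bridge makes S the disjoint union of two smaller closed
   sets, at the cost of one edge, that is 2 in the degree sum. *)
Lemma forest_degree_sum e S :
    symmetric e -> irreflexive e -> S != set0 ->
    (forall x y, x \in S -> e x y -> y \in S) ->
    (forall u v, u \in S -> e u v -> ~~ connect (del_edge e u v) u v) ->
  \sum_(x in S) nbdeg e x + 2 <= 2 * #|S|.
Proof.
have [m leSm] := ubnP #|S|; elim: m e S leSm => // m IH e S leSm sy ir S0 cl br.
have S1 : 0 < #|S| by rewrite card_gt0.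
have [/existsP[u /andP[uS /existsP[v euv]]]|no] :=
  boolP [exists u, (u \in S) && [exists v, e u v]]; last first.
  rewrite big1 ?add0n; first by lia.
  move=> x xS; apply/eqP; rewrite cards_eq0; apply/eqP/setP=> y; rewrite !inE.
  apply: contraNF no => exy; apply/existsP; exists x; rewrite xS /=.
  by apply/existsP; exists y.
have uv : u != v by apply: contraTneq euv => ->; rewrite ir.
set e' := del_edge e u v.
have sy' : symmetric e' by apply: del_edgeC.
have sub' a b : e' a b -> e a b by case/andP.
have ir' : irreflexive e' by move=> a; rewrite /e' /del_edge ir.
pose S1' := [set x in S | connect e' u x].
pose S2' := [set x in S | ~~ connect e' u x].
have vS : v \in S by apply: cl uS euv.
have u1 : u \in S1' by rewrite inE uS connect0.
have v2 : v \in S2' by rewrite inE vS br.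
have cl1 x y : x \in S1' -> e' x y -> y \in S1'.
  rewrite !inE => /andP[xS ux] exy; rewrite (cl x) ?sub' //=.
  exact: connect_trans ux (connect1 exy).
have cl2 x y : x \in S2' -> e' x y -> y \in S2'.
  rewrite !inE => /andP[xS ux] exy; rewrite (cl x) ?sub' //=.
  apply: contra ux => uy; apply: connect_trans uy (connect1 _).
  by rewrite sy'.
(* Deleting further edges cannot reconnect the ends of a bridge, so the bridges of [e] stay bridges
   in [e']. *)
have br' a b : a \in S -> e' a b -> ~~ connect (del_edge e' a b) a b.
  move=> aS eab; apply: contra (br a b aS (sub' _ _ eab)).
  apply: connect_sub => c d /andP[/sub' ecd nab]; apply: connect1.
  by rewrite /del_edge ecd.
have cardS : #|S| = #|S1'| + #|S2'|.
  rewrite -(cardsID [set x | connect e' u x] S); congr (_ + _); apply: eq_card => x;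
    by rewrite !inE // andbC.
have c1 : 0 < #|S1'| by apply/card_gt0P; exists u.
have c2 : 0 < #|S2'| by apply/card_gt0P; exists v.
have I1 := IH e' S1' _ sy' ir' _ cl1 _.
have I2 := IH e' S2' _ sy' ir' _ cl2 _.
have {}I1 : \sum_(x in S1') nbdeg e' x + 2 <= 2 * #|S1'|.
  apply: I1; rewrite -?card_gt0 //; first by lia.
  by move=> a b; rewrite inE => /andP[aS _]; apply: br'.
have {}I2 : \sum_(x in S2') nbdeg e' x + 2 <= 2 * #|S2'|.
  apply: I2; rewrite -?card_gt0 //; first by lia.
  by move=> a b; rewrite inE => /andP[aS _]; apply: br'.
have -> : \sum_(x in S) nbdeg e x =
    \sum_(x in S) nbdeg e' x + (\sum_(x in S) ((x == u) : nat) + \sum_(x in S) ((x == v) : nat)).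
  rewrite -!big_split /=; apply: eq_bigr => x _.
  by rewrite (@nbdeg_del e u v).
have sumS : \sum_(x in S) nbdeg e' x =
    \sum_(x in S1') nbdeg e' x + \sum_(x in S2') nbdeg e' x.
  rewrite (bigID (connect e' u)) /=.
  by congr (_ + _); apply: eq_bigl => x; rewrite inE.
have le1 w : \sum_(x in S) ((x == w) : nat) <= 1.
  rewrite -(sum_eq1 w) [X in _ <= X](bigID (mem S)) /=; exact: leq_addr.
have := le1 u; have := le1 v; rewrite sumS cardS; lia.
Qed.

(** Contrapositive of [forest_degree_sum]: a closed set with too many edges for a forest contains an
    edge on a cycle. *)
Lemma nonbridge_exists e S :
    symmetric e -> irreflexive e -> S != set0 ->
    (forall x y, x \in S -> e x y -> y \in S) ->
    2 * #|S| < \sum_(x in S) nbdeg e x + 2 ->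
  exists u v, [/\ u \in S, e u v & connect (del_edge e u v) u v].
Proof.
move=> sy ir S0 cl lt.
have [/existsP[u /existsP[v /and3P[]]]|no] :=
  boolP [exists u, exists v, [&& u \in S, e u v & connect (del_edge e u v) u v]].
  by exists u, v.
suff: \sum_(x in S) nbdeg e x + 2 <= 2 * #|S| by lia.
apply: forest_degree_sum => // u v uS euv.
apply: contra no => con; apply/existsP; exists u; apply/existsP; exists v.
by rewrite uS euv.
Qed.

(** * The 2-switch between two components *)

Section Switch.
Variables (e : rel T) (u v x y : T).
Hypotheses (sy : symmetric e) (ir : irreflexive e) (euv : e u v) (exy : e x y).
Hypothesis far : ~~ connect e u x.

Let conS : connect_sym e := sym_connect_sym sy.

Let nux : u != x. Proof. by apply: contraNneq far => ->; apply: connect0. Qed.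
Let nvx : v != x. Proof. by apply: contraNneq far => <-; apply: connect1. Qed.
Let nuy : u != y.
Proof. by apply: contraNneq far => ->; rewrite conS connect1. Qed.
Let nvy : v != y.
Proof.
apply: contraNneq far => vy; rewrite (@connect_trans _ _ v) ?connect1 //.
by rewrite vy sy.
Qed.
Let nuv : u != v. Proof. by apply: contraTneq euv => ->; rewrite ir. Qed.
Let nxy : x != y. Proof. by apply: contraTneq exy => ->; rewrite ir. Qed.
Let eux : e u x = false.
Proof. by apply: contraNF far; apply: connect1. Qed.
Let evy : e v y = false.
Proof.
apply: contraNF far => evy; apply: connect_trans (connect1 euv) _.
by apply: connect_trans (connect1 evy) _; rewrite connect1 // sy.
Qed.

Lemma switch_sym : symmetric (switch e u v x y).
Proof.
move=> a b; rewrite /switch !(pair_relC _ _ a b); congr orb.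
by do 2!apply: del_edgeC.
Qed.

Lemma switch_irr : irreflexive (switch e u v x y).
Proof.
move=> a; rewrite /switch /del_edge ir /= /pair_rel.
have [->|_] := eqVneq a u; first by rewrite (negbTE nux) (negbTE nuv) /= andbF.
have [->|_] := eqVneq a v; first by rewrite (negbTE nvy) andbF.
by rewrite !andbF.
Qed.

(** By [far], the four ends are distinct and [u x], [v y] are non-edges. Each end lies on exactly
    one removed and one added pair, so the corrections cancel once both are written as sums of
    indicators. *)
Lemma nbdeg_switch a : nbdeg (switch e u v x y) a = nbdeg e a.
Proof.
suff E : nbdeg (switch e u v x y) a
    + (\sum_b (pair_rel u v a b : nat) + \sum_b (pair_rel x y a b : nat)) =
    nbdeg e a + (\sum_b (pair_rel u x a b : nat) + \sum_b (pair_rel v y a b : nat)).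
  by move: E; rewrite !sum_pair_rel // (addnACA (a == u : nat)) => /addIn.
rewrite !nbdeg_sum -!big_split /=; apply: eq_bigr => b _.
have D w z w' z' : pair_rel w z a b -> pair_rel w' z' a b -> pair_rel w z w' z'.
  rewrite /pair_rel => /orP[]/andP[/eqP-> /eqP->] /orP[]/andP[/eqP-> /eqP->];
  by rewrite !eqxx ?orbT.
have P w z : pair_rel w z a b -> e a b = e w z.
  by case/orP=> /andP[/eqP-> /eqP->] //; rewrite sy.
have neq := (negbTE nux, negbTE nuy, negbTE nvx, negbTE nvy, negbTE nuv, negbTE nxy).
have [D1 D2 D3] : [/\ pair_rel u v x y = false, pair_rel u v u x = false
    & pair_rel u v v y = false].
  by rewrite /pair_rel !(eq_sym x) !(eq_sym y) !(eq_sym v u) !neq !eqxx /= ?andbF.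
have [D4 D5 D6] : [/\ pair_rel x y u x = false, pair_rel x y v y = false
    & pair_rel u x v y = false].
  by rewrite /pair_rel !(eq_sym x) !(eq_sym y) !(eq_sym v u) !neq !eqxx /= ?andbF.
rewrite /switch /del_edge.
move: (D u v x y) (D u v u x) (D u v v y) (D x y u x) (D x y v y) (D u x v y).
move: (P u v) (P x y) (P u x) (P v y).
rewrite D1 D2 D3 D4 D5 D6 euv exy eux evy.
case: (e a b); case: (pair_rel u v a b); case: (pair_rel x y a b);
case: (pair_rel u x a b); case: (pair_rel v y a b) => *;
by repeat match goal with H : is_true true -> _ |- _ => specialize (H isT) end.
Qed.

Lemma switch_realizes d : realizes d e -> realizes d (switch e u v x y).
Proof.
case=> _ _ dE; split; [exact: switch_sym|exact: switch_irr|].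
by move=> a; rewrite nbdeg_switch.
Qed.

Hypothesis nonbridge : connect (del_edge e u v) u v.

Let e' := switch e u v x y.
Let conS' : connect_sym e' := sym_connect_sym switch_sym.

Lemma connect_switch_ux : connect e' u x.
Proof. by apply: connect1; rewrite /e' /switch /pair_rel !eqxx orbT. Qed.

(** The detour from [u] to [v] stays in the component of [u]; the other deleted edge [x y] lies
    elsewhere, so the detour survives the switch. *)
Lemma connect_switch_uv : connect e' u v.
Proof.
pose S := [set a | connect e u a].
apply: (@connect_restrict (del_edge e u v) e' S) nonbridge; last by rewrite inE.
  by move=> a b; rewrite !inE => ua /andP[eab _]; apply: connect_trans ua (connect1 eab).
move=> a b; rewrite inE => ua eab; apply: connect1; rewrite /e' /switch.
rewrite {1}/del_edge eab /=.
suff /negbTE-> : ~~ pair_rel x y a b by [].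
apply: contra far => /orP[]/andP[/eqP ax /eqP bx]; first by rewrite -ax.
apply: connect_trans ua _; by rewrite ax connect1 // sy.
Qed.

(** Only two edges disappear: [u v] is replaced by the detour, and [x y] by the route from [x] to
    [u], along the detour to [v], then to [y]. *)
Lemma connect_switch : subrel (connect e) (connect e').
Proof.
apply: connect_sub => a b eab.
have uv := connect_switch_uv; have ux := connect_switch_ux.
have vy : connect e' v y by apply: connect1; rewrite /e' /switch /pair_rel !eqxx !orbT.
have xy : connect e' x y.
  apply: connect_trans (connect_trans uv vy); by rewrite conS'.
have [/orP[]/andP[/eqP-> /eqP->] //|n1] := boolP (pair_rel u v a b).
  by rewrite conS'.
have [/orP[]/andP[/eqP-> /eqP->] //|n2] := boolP (pair_rel x y a b).
  by rewrite conS'.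
by apply: connect1; rewrite /e' /switch /del_edge eab n1 n2.
Qed.
End Switch.

(** The degree sum allows a spanning tree on the support. While some vertex of the support is not
    reached from [v0], a switch through a non-bridge edge reaches a new one and loses none; the
    induction is on the number of unreached vertices. *)
Lemma realizes_connected d e v0 : realizes d e -> 0 < d v0 ->
    2 * #|[set x | 0 < d x]| <= \sum_x d x + 2 ->
  exists e', realizes d e' /\ forall x, 0 < d x -> connect e' v0 x.
Proof.
move=> + dv0 le2; pose S := [set x | 0 < d x].
have [m] := ubnP #|[set x in S | ~~ connect e v0 x]|.
elim: m e => // m IH e ltm re; have [sy ir dE] := re.
pose C := [set x | connect e v0 x]; pose O := [set x in S | ~~ connect e v0 x].
have conS := sym_connect_sym sy.
have [O0|O0] := eqVneq O set0.
  exists e; split=> // x dx; apply: contraT => nx.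
  by have : x \in O; [rewrite !inE dx|rewrite O0 inE].
have step e1 z : realizes d e1 -> subrel (connect e) (connect e1) ->
    z \in O -> connect e1 v0 z ->
    exists e', realizes d e' /\ forall x, 0 < d x -> connect e' v0 x.
  move=> r1 sub zO cz; apply: (IH e1) => //.
  apply: leq_trans (_ : _ <= #|O|) _; last by [].
  apply: proper_card; apply/properP; split.
    apply/subsetP=> a; rewrite !inE => /andP[-> /=]; apply: contra; exact: sub.
  by exists z; rewrite // inE cz andbF.
have edge x : 0 < d x -> exists y, e x y.
  by rewrite -dE => /card_gt0P[y]; rewrite inE; exists y.
have dpos x y : e x y -> 0 < d x.
  by move=> exy; rewrite -dE; apply/card_gt0P; exists y; rewrite inE.
have clC a b : a \in C -> e a b -> b \in C.
  by rewrite !inE => va eab; apply: connect_trans va (connect1 eab).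
have clO a b : a \in O -> e a b -> b \in O.
  rewrite !inE => /andP[_ na] eab; rewrite (dpos b a) 1?sy //=.
  by apply: contra na => vb; apply: connect_trans vb (connect1 _); rewrite sy.
have v0C : v0 \in C by rewrite inE.
have CS : C \subset S.
  apply/subsetP=> a; rewrite !inE conS => /connectP[[|b p] /=]; first by move=> _ <-.
  by case/andP=> /dpos.
have cardS : #|S| = #|C| + #|O|.
  rewrite -(cardsID C S); congr (_ + _); apply: eq_card => a; rewrite !inE.
    by have /subsetP/(_ a) := CS; rewrite !inE; case: connect => [->|] //; rewrite andbF.
  by rewrite andbC.
have sumS : \sum_x d x = \sum_(x in C) nbdeg e x + \sum_(x in O) nbdeg e x.
  rewrite (bigID (mem C)) /=; congr (_ + _); first by apply: eq_bigr.
  rewrite (bigID (fun x => 0 < d x)) /= [X in _ + X = _]big1 ?addn0.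
    by apply: eq_big => [a|//]; rewrite !inE andbC.
  by move=> a /andP[_]; rewrite -leqNgt leqn0 => /eqP.
(* If both [C] and [O] met the forest bound, the degree sum plus 4 would be at most [2 * #|S|],
   against [le2]. So one of them has a non-bridge edge, to be switched with any edge of the
   other. *)
have [ltC|leC] := ltnP (2 * #|C|) (\sum_(x in C) nbdeg e x + 2).
  have [|u [v [uC euv nb]]] := nonbridge_exists sy ir _ clC ltC.
    by apply/set0Pn; exists v0.
  have [x xO] := set0Pn _ O0.
  have [y exy] : exists y, e x y by apply: edge; move: xO; rewrite !inE => /andP[].
  have far : ~~ connect e u x.
    move: uC xO; rewrite !inE => vu /andP[_]; apply: contra; exact: connect_trans vu.
  have sub := connect_switch sy exy far nb.
  apply: (step _ x _ sub xO); first exact: switch_realizes.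
  apply: connect_trans (connect_switch_ux e u v x y).
  by apply: sub; move: uC; rewrite inE.
have ltO : 2 * #|O| < \sum_(x in O) nbdeg e x + 2.
  by move: le2; rewrite -/S cardS sumS; lia.
have [u [v [uO euv nb]]] := nonbridge_exists sy ir O0 clO ltO.
have [y exy] := edge _ dv0.
have far : ~~ connect e u v0 by move: uO; rewrite !inE conS => /andP[].
have sub := connect_switch sy exy far nb.
apply: (step _ u _ sub uO); first exact: switch_realizes.
rewrite (sym_connect_sym (switch_sym u v v0 y sy)).
exact: connect_switch_ux.
Qed.

End Degrees.

(** * Degree functions without gaps *)

Section HavelHakimi.
Variable T : finType.
Implicit Types (e : rel T) (d : T -> nat) (S : {set T}).

Lemma top_set d (A : {set T}) k : k <= #|A| ->
  exists S, [/\ S \subset A, #|S| = k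
    & forall x y, x \in S -> y \in A :\: S -> d y <= d x].
Proof.
elim: k => [_|k IH leA].
  by exists set0; split; rewrite ?sub0set ?cards0 // => x y; rewrite inE.
have [S [sA cS top]] := IH (ltnW leA).
have /card_gt0P[z0 z0P] : 0 < #|A :\: S|.
  by rewrite cardsD (setIidPr sA) cS subn_gt0.
have [z zP zmax] := arg_maxnP d z0P.
have /andP[zS zA] : (z \notin S) && (z \in A) by move: (zP : z \in A :\: S); rewrite inE.
exists (z |: S); split.
- by rewrite subUset sub1set zA.
- by rewrite cardsU1 zS cS.
move=> x y /setU1P[->|xS]; rewrite !inE negb_or => /andP[/andP[_ yS] yA].
  have yD : y \in A :\: S by rewrite inE yS.
  exact: zmax yD.
by apply: top; rewrite // inE yS.
Qed.

(** The backward Havel-Hakimi step: [v] is isolated in the reduced realization, so joining it to [S]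
    never doubles an edge. *)
Lemma attach_vertex d (v : T) S :
    v \notin S -> #|S| = d v -> (forall x, x \in S -> 0 < d x) ->
    (exists e, realizes (fun x => if x == v then 0 else d x - (x \in S)) e) ->
  exists e, realizes d e.
Proof.
move=> vS cS pS [e [sy ir dE]].
have ev y : e v y = false.
  by have /eqP := dE v; rewrite eqxx cards_eq0 => /eqP/setP/(_ y); rewrite !inE.
have ev' y : e y v = false by rewrite sy.
exists (fun x y => [|| e x y, (x == v) && (y \in S) | (y == v) && (x \in S)]).
split=> [x y|x|x].
- by rewrite sy; congr orb; rewrite orbC.
- by rewrite ir /=; case: eqP => // ->; rewrite (negbTE vS).
have [->|xv] := eqVneq x v.
  rewrite -cS; apply: eq_card => y; rewrite inE ev eqxx /= (negbTE vS) andbF.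
  by rewrite orbF.
have := dE x; rewrite (negbTE xv) !nbdeg_sum => H.
rewrite (bigD1 v) //= ev' (negbTE xv) eqxx /=.
rewrite (eq_bigr (fun y => e x y : nat)); last first.
  by move=> y /negbTE ->; rewrite orbF.
move: H; rewrite (bigD1 v) //= ev' /= add0n => ->.
by case: (boolP (x \in S)) => [/pS|_] /=; lia.
Qed.

Lemma card_values d (X : {set T}) a b :
  (forall k, a <= k < b -> exists2 x, x \in X & d x = k) -> b - a <= #|X|.
Proof.
move=> val; rewrite -[b - a](size_iota a) cardE -(size_map d (enum X)).
apply: uniq_leq_size (iota_uniq _ _) _ => k; rewrite mem_iota => kab.
have [|x xX <-] := val k; first by lia.
by apply: map_f; rewrite mem_enum.
Qed.

(* Havel-Hakimi: joining a vertex of maximal degree to the largest others leaves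
   no gaps, and the support stays large because few vertices drop to degree 0. *)
Lemma gap_free_graphic d h :
    (forall x, d x <= h) -> (forall k, 0 < k <= h -> exists x, d x = k) ->
    2 * h <= #|[set x | 0 < d x]| -> ~~ odd (\sum_x d x) ->
  exists e, realizes d e.
Proof.
have [m] := ubnP (\sum_x d x).
elim: m d h => // m IH d h ltm leh full supp ev.
have [h0|h_gt0] := posnP h.
  exists (fun _ _ => false); split=> // x; have := leh x; rewrite h0 leqn0 => /eqP ->.
  by apply/eqP; rewrite cards_eq0; apply/eqP/setP=> y; rewrite !inE.
have [v dv] : exists v, d v = h by apply: full; rewrite h_gt0 leqnn.
pose A := [set x | (0 < d x) && (x != v)].
have suppA : #|[set x | 0 < d x]| = #|A|.+1.
  rewrite (cardsD1 v) inE dv h_gt0 add1n; congr _.+1; apply: eq_card => x.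
  by rewrite !inE andbC.
have [|S [sA cS top]] := @top_set d A h; first by lia.
have vS : v \notin S.
  by apply/negP=> /(subsetP sA); rewrite !inE eqxx andbF.
have pS x : x \in S -> 0 < d x by move=> /(subsetP sA); rewrite !inE => /andP[].
have {}top x y : x \in S -> y \notin S -> y != v -> d y <= d x.
  move=> xS yS yv; have [->//|dy] := posnP (d y).
  by apply: top; rewrite // !inE yS dy.
apply: (@attach_vertex d v S vS) => //; first by rewrite cS dv.
pose d' x := if x == v then 0 else d x - (x \in S).
rewrite -/d'.
(* The sum loses [h] at [v] and 1 at each of its [h] neighbours, so it decreases and keeps its
   parity. *)
have sumd : \sum_x d x = \sum_x d' x + 2 * h.
  have -> : 2 * h = \sum_(x : T) ((x \in S) : nat) + \sum_(x : T) ((x == v) : nat) * h.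
    rewrite -big_distrl /= sum_eq1 mul1n -[in RHS]big_mkcond /= sum1_card cS; lia.
  rewrite -!big_split /=; apply: eq_bigr => x _; rewrite /d'.
  have [->|xv] := eqVneq x v; first by rewrite (negbTE vS) dv; lia.
  by case: (boolP (x \in S)) => [/pS|_] /=; lia.
have cT : 0 < #|T| by apply/card_gt0P; exists v.
have [z zmax] := eq_bigmax d' cT.
pose h' := d' z.
have leh' x : d' x <= h' by rewrite /h' -zmax; apply: leq_bigmax.
have d'v : d' v = 0 by rewrite /d' eqxx.
have d'S x : x \in S -> d' x = (d x).-1.
  move=> xS; rewrite /d' xS subn1; case: eqP => // xv.
  by move: vS; rewrite -xv xS.
have d'N x : x != v -> x \notin S -> d' x = d x.
  by move=> /negbTE xv /negbTE xS; rewrite /d' xv xS subn0.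
have d'_le x : d' x <= d x by rewrite /d'; case: eqP; rewrite ?leq_subr.
have zv : 0 < h' -> z != v by move=> p; apply/eqP=> E; move: p; rewrite /h' E d'v.
(* A vertex of degree [k] outside [S] still has it. If it lies in [S], then a vertex of degree
   [k.+1] other than [v] lies in [S] too, by [top], and drops to [k]. *)
have full' k : 0 < k <= h' -> exists x, d' x = k.
  case/andP=> k0; rewrite leq_eqVlt => /predU1P[->|kh']; first by exists z.
  have nzv : z != v by apply: zv; lia.
  have dz : k.+1 <= d z by apply: leq_trans (d'_le z).
  have [x dx] : exists x, d x = k by apply: full; have := leh z; lia.
  have xv : x != v by apply: contraTneq dz => xv; have := leh z; rewrite -dv -xv dx; lia.
  have [xS|xS] := boolP (x \in S); last by exists x; rewrite d'N.
  have [y yv dy] : exists2 y, y != v & d y = k.+1.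
    have := leh z; have [kh|kh] := ltnP k.+1 h => dzh.
      have [|y dy] := full k.+1; first by lia.
      by exists y => //; apply: contraTneq kh => yv; rewrite -dv -yv dy ltnn.
    by exists z => //; lia.
  have yS : y \in S.
    by apply: contraT => yS; have := top x y xS yS yv; rewrite dx dy ltnn.
  by exists y; rewrite d'S // dy.
(* The vertices that drop to degree 0: the support loses exactly [v] and [Z]. What remains is to
   show that it still has at least [2 * h'] elements. *)
pose Z := [set x in S | d x == 1].
have suppE : #|[set x | 0 < d x]| = #|[set x | 0 < d' x]| + 1 + #|Z|.
  rewrite suppA addn1 addSn; congr _.+1.
  rewrite -(cardsID Z A) addnC; congr (_ + _); apply: eq_card => x; rewrite !inE.
    have [->|xv] := eqVneq x v; first by rewrite d'v /= !andbF.
    have [xS|xS] := boolP (x \in S); last by rewrite (d'N x) //= andbT.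
    by rewrite d'S // andbT; have := pS x xS; lia.
  case: (boolP (x \in S)) => [xS|]; last by rewrite andbF.
  by have := subsetP sA _ xS; rewrite !inE => ->.
have par : ~~ odd (\sum_x d' x) by move: ev; rewrite sumd oddD mul2n odd_double addbF.
apply: (IH d' h') => //; first by lia.
have [h'0|h'0] := posnP h'; first by rewrite h'0.
(* When [h'] is 1 the support is as large as the even residual sum; being nonempty, it has at least
   2 elements. *)
have [h'1|h'1] := leqP h' 1.
  have E : \sum_x d' x = #|[set x | 0 < d' x]|.
    rewrite -sum1dep_card [RHS]big_mkcond /=; apply: eq_bigr => x _.
    by have := leh' x; case: (d' x) => [|[|]] //; lia.
  have : 0 < #|[set x | 0 < d' x]| by apply/card_gt0P; exists z; rewrite inE.
  by move: par; rewrite E; lia.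
have nzv := zv h'0.
have h'h : h' <= h by apply: leq_trans (d'_le z) (leh z).
have [Z0|[w]] := set_0Vmem Z.
  move: suppE; rewrite Z0 cards0 addn0 => suppE.
  (* Only [v] is lost, which matters only if the maximum stays [h]. Then [z] is outside [S], so [z],
     [v] and all of [S] have degree [h]; with the [h - 1] smaller values the support had at least
     [2 * h + 1] elements. *)
  have [h'E|ne] := eqVneq h' h; last by lia.
  have zS : z \notin S.
    apply/negP=> zS; have := d'S z zS; have := leh z; have := pS z zS.
    by rewrite -/h' h'E; lia.
  have dz : d z = h by rewrite -(d'N z) // -h'E.
  have lo : h - 1 <= #|[set x | 0 < d x < h]|.
    apply: (@card_values d) => k kh; have [|x dx] := full k; first by lia.
    by exists x; rewrite // inE dx; lia.
  have hi : h + 2 <= #|[set x | d x == h]|.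
    apply: leq_trans (_ : #|z |: (v |: S)| <= _).
      by rewrite !cardsU1 !inE negb_or nzv zS vS cS; lia.
    apply: subset_leq_card; apply/subsetP=> x; rewrite !inE.
    case/or3P=> [/eqP->|/eqP->|xS]; rewrite ?dz ?dv //.
    by have := top x z xS zS nzv; have := leh x; rewrite dz; lia.
  have tot : #|[set x | 0 < d x]| = #|[set x | 0 < d x < h]| + #|[set x | d x == h]|.
    rewrite -(cardsID [set x | d x == h]) addnC; congr (_ + _); apply: eq_card => x;
      rewrite !inE; have := leh x; lia.
  lia.
(* Since [S] contains a vertex of degree 1, all vertices of degree at least 2 other than [v] lie in
   [S]. They form [Q], which takes the values 2 to [h - 1], so [Z] has at most 2 elements. *)
rewrite inE => /andP[wS /eqP dw].
have out x : x != v -> x \notin S -> d x <= 1.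
  by move=> xv xS; rewrite -dw; apply: top.
pose Q := [set x | (1 < d x) && (x != v)].
have QZ : #|Q| + #|Z| <= h.
  rewrite -cS -(cardsID Z S) addnC leq_add //; apply: subset_leq_card; apply/subsetP=> x.
    by rewrite !inE => /andP[-> ->].
  rewrite !inE => /andP[d1 xv].
  have xS : x \in S by apply: contraT => xS; have := out x xv xS; lia.
  by rewrite xS; lia.
have low : h - 2 <= #|Q|.
  apply: (@card_values d) => k kh; have [|x dx] := full k; first by lia.
  exists x; rewrite // inE dx; apply/andP; split; first by lia.
  by apply: contraTneq kh => xv; rewrite -dx xv dv; lia.
have zS : z \in S.
  apply: contraT => zS; have := out z nzv zS; have := d'N z nzv zS.
  by rewrite -/h'; lia.
have dz : d z = h'.+1 by have := d'S z zS; have := pS z zS; rewrite -/h'; lia.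
have h'lt : h' < h by have := leh z; rewrite dz.
have [Z1|Z2] := leqP #|Z| 1; first by lia.
(* If the maximum drops only by 1, then [z] has degree [h], so [Q] takes one value more and [Z]
   cannot have 2 elements. *)
have [h'E|ne] := eqVneq h'.+1 h; last by lia.
have : h.+1 - 2 <= #|Q|; last by lia.
apply: (@card_values d) => k kh; have [->|kn] := eqVneq k h.
  by exists z; [rewrite inE nzv dz; lia|rewrite dz].
have [|x dx] := full k; first by lia.
exists x; rewrite // inE dx; apply/andP; split; first by lia.
by apply: contra_neq kn => xv; rewrite -dx xv dv.
Qed.
End HavelHakimi.

(** * Gluing two halves *)

Section TwoHalves.
Variable T : finType.
Implicit Types (e : rel T) (d : T -> nat) (A B : {set T}).

Lemma gap_free_connected d h :
    (forall x, d x <= h) -> (forall k, 0 < k <= h -> exists x, d x = k) ->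
    2 * h <= #|[set x | 0 < d x]| -> ~~ odd (\sum_x d x) ->
    2 * #|[set x | 0 < d x]| <= \sum_x d x + 2 ->
  exists e, realizes d e /\
    forall x y, 0 < d x -> 0 < d y -> connect e x y.
Proof.
move=> leh full supp ev le2; have [e re] := gap_free_graphic leh full supp ev.
have [S0|[v0]] := set_0Vmem [set x | 0 < d x].
  by exists e; split=> // x y dx; move/setP/(_ x): S0; rewrite !inE dx.
rewrite inE => dv0; have [e' [re' con]] := realizes_connected re dv0 le2.
exists e'; split=> // x y dx dy; apply: connect_trans (con y dy).
by case: re' => sy _ _; rewrite (sym_connect_sym sy) con.
Qed.

(* When the volume of B is odd, one edge end at a vertex b of maximal degree is
   left unused; it is later joined to the one left over on the other side. *)
Lemma half_realization d h B :
    1 < h -> (forall x, 0 < d x <= h) ->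
    (forall k, 0 < k <= h -> exists2 x, x \in B & d x = k) ->
    2 * h <= #|B| -> 2 * #|B| <= \sum_(x in B) d x ->
  exists b e, [/\ b \in B,
    realizes (fun x => if x \in B
      then d x - (odd (\sum_(x in B) d x) && (x == b)) else 0) e
    & forall x y, x \in B -> y \in B -> connect e x y].
Proof.
move=> h1 dh full hB le2; set p := odd _.
have [b bB db] : exists2 b, b \in B & d b = h by apply: full; lia.
pose d1 x := if x \in B then d x - (p && (x == b)) else 0.
exists b; rewrite -/d1.
have d1b : d1 b = h - p by rewrite /d1 bB eqxx andbT db.
have d1N x : x \in B -> x != b -> d1 x = d x.
  by move=> xB /negbTE xb; rewrite /d1 xB xb andbF subn0.
have d1le x : d1 x <= d x by rewrite /d1; case: ifP => // _; rewrite leq_subr.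
have pos x : (0 < d1 x) = (x \in B).
  have [->|xb] := eqVneq x b; first by rewrite d1b bB; lia.
  rewrite /d1 (negbTE xb) andbF subn0; case: ifP => //.
  by have := dh x; lia.
have sumE : \sum_(x in B) d x = \sum_x d1 x + p.
  rewrite [X in X + _](bigID (mem B)) /= [X in _ + X + _]big1 ?addn0; last first.
    by move=> x /negbTE xB; rewrite /d1 xB.
  rewrite (bigD1 b) //= [X in X + _ = _]db [in RHS](bigD1 b) //= d1b.
  rewrite (eq_bigr d1); first by lia.
  by move=> x /andP[xB xb]; rewrite d1N.
have supp : [set x | 0 < d1 x] = B by apply/setP=> x; rewrite inE pos.
(* Lowering [b] may remove the only occurrence of [h] in [B]; the new maximum is then [h - 1], and
   no gap appears. *)
have [h2 [h2h leh2 full2]] : exists h2, [/\ h2 <= h, (forall x, d1 x <= h2)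
    & forall k, 0 < k <= h2 -> exists x, d1 x = k].
  have low k : 0 < k < h -> exists x, d1 x = k.
    move=> kh; have [|x xB dx] := full k; first by lia.
    exists x; rewrite d1N //; apply: contraTneq kh => xb.
    by rewrite -dx xb db; lia.
  have [/existsP[x /eqP dx]|no] := boolP [exists x, d1 x == h].
    exists h; split=> // [y|k].
      by apply: leq_trans (d1le y) _; case/andP: (dh y).
    by rewrite andbC leq_eqVlt => /andP[/predU1P[->|]]; [exists x|move=> *; apply: low; lia].
  exists (h - 1); split=> [|x|k kh]; [by lia| |by apply: low; lia].
  have := d1le x; have /andP[_] := dh x.
  have : d1 x != h by apply: contra no => dx; apply/existsP; exists x.
  by lia.
have [|||e [re con]] := @gap_free_connected d1 h2 leh2 full2.
- by rewrite supp; lia.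
- have : odd (\sum_(x in B) d x) = odd (\sum_x d1 x + p) by rewrite sumE.
  by rewrite -/p oddD; case: (p); case: odd.
- by rewrite supp; move: le2; rewrite sumE; lia.
by exists e; split=> // x y xB yB; apply: con; rewrite pos.
Qed.

Definition cut e A : nat := \sum_(x in A) \sum_(y in ~: A) (e x y : nat).

Lemma cut_pair_rel A u v : u \in A -> v \notin A -> cut (pair_rel u v) A <= 1.
Proof.
move=> uA vA; rewrite -(sum_eq1 u) [X in _ <= X](bigID (mem A)) /=.
apply: leq_trans (leq_addr _ _); apply: leq_sum => x xA.
have xv : x != v by apply: contraTneq xA => ->.
apply: leq_trans (_ : \sum_(y : T) (x == u) * ((y == v) : nat) <= _).
  rewrite [X in _ <= X](bigID (mem (~: A))) /=; apply: leq_trans (leq_addr _ _).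
  apply: leq_sum => y _; rewrite /pair_rel (negbTE xv) orbF.
  by case: eqP; case: eqP.
by rewrite -big_distrr /= sum_eq1 muln1.
Qed.

Lemma leq_cut e e' A :
  (forall x y, x \in A -> y \notin A -> e x y -> e' x y) -> cut e A <= cut e' A.
Proof.
move=> sub; apply: leq_sum => x xA; apply: leq_sum => y; rewrite inE => yA.
by have := sub x y xA yA; case: (e x y) => // ->.
Qed.

Lemma cutU e e' A : cut (fun x y => e x y || e' x y) A <= cut e A + cut e' A.
Proof.
rewrite -big_split /=; apply: leq_sum => x _.
rewrite -big_split /=; apply: leq_sum => y _.
by case: (e x y); case: (e' x y).
Qed.

Lemma realizes_pos d e x y : realizes d e -> e x y -> 0 < d x /\ 0 < d y.
Proof.
case=> sy _ dE exy; rewrite -!dE; split; apply/card_gt0P; [exists y|exists x];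
by rewrite inE // sy.
Qed.

(** The volumes of the two sides have the same parity. If odd, the edge [a b] uses up the two free
    ends. If even, side [A] has too many edges for a forest, and a non-bridge edge of it is switched
    with an edge at [b]. *)
Lemma two_halves_realization d h A :
    1 < h -> (forall x, 0 < d x <= h) ->
    (forall k, 0 < k <= h -> exists2 x, x \in A & d x = k) ->
    (forall k, 0 < k <= h -> exists2 x, x \in ~: A & d x = k) ->
    2 * h <= #|A| -> 2 * h <= #|~: A| ->
    2 * #|A| <= \sum_(x in A) d x -> 2 * #|~: A| <= \sum_(x in ~: A) d x ->
    ~~ odd (\sum_x d x) ->
  exists e, [/\ realizes d e, forall x y, connect e x y & cut e A <= 2].
Proof.
move=> h1 dh fA fB hA hB sA sB ev.
have [a [eA [aA rA cA]]] := half_realization h1 dh fA hA sA.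
have [b [eB [bB rB cB]]] := half_realization h1 dh fB hB sB.
have pE : odd (\sum_(x in ~: A) d x) = odd (\sum_(x in A) d x).
  have -> : \sum_(x in ~: A) d x = \sum_(x | x \notin A) d x.
    by apply: eq_bigl => x; rewrite inE.
  by move: ev; rewrite (bigID (mem A)) /= oddD; case: odd; case: odd.
rewrite pE in rB; move: rA rB; set p := odd _ => rA rB.
have sAe x y : eA x y -> (x \in A) && (y \in A).
  by case/(realizes_pos rA); case: ifP => // _ _; case: ifP.
have sBe x y : eB x y -> (x \notin A) && (y \notin A).
  by case/(realizes_pos rB); rewrite !inE; case: ifP => // _ _; case: ifP.
pose f x y := eA x y || eB x y.
have [syA irA dA] := rA; have [syB irB dB] := rB.
have syf : symmetric f by move=> x y; rewrite /f syA syB.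
have irf : irreflexive f by move=> x; rewrite /f irA irB.
have bA : b \notin A by move: bB; rewrite inE.
have df x : nbdeg f x = d x - (p && ((x == a) || (x == b))).
  have -> : nbdeg f x = nbdeg eA x + nbdeg eB x.
    rewrite !nbdeg_sum -big_split /=; apply: eq_bigr => y _; rewrite /f.
    have := @sAe x y; have := @sBe x y; case: (eA x y); case: (eB x y) => //.
    by move=> /(_ isT)/andP[/negbTE-> _] /(_ isT).
  rewrite dA dB !inE; have [xA|xA] := boolP (x \in A); rewrite /= ?addn0.
    by have -> : x == b = false; [apply: contraNF bA => /eqP <-|rewrite orbF].
  by have -> : x == a = false; [apply: contraNF xA => /eqP ->|].
have clf x y : x \in A -> f x y -> y \in A.
  by move=> xA /orP[/sAe/andP[]|/sBe/andP[]] //; rewrite xA.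
have clfc x y : x \in A -> connect f x y -> y \in A.
  move=> xA /connectP[q]; elim: q x xA => [|z q IH] x xA /=; first by move=> _ ->.
  by case/andP=> /(clf _ _ xA) zA; apply: IH.
have cf x y : (x \in A) = (y \in A) -> connect f x y.
  have [xA|xA] := boolP (x \in A) => yA.
    apply: connect_sub (cA x y xA _); last by rewrite -yA.
    by move=> u v uv; apply: connect1; rewrite /f uv.
  apply: connect_sub (cB x y _ _); rewrite ?inE -?yA //.
  by move=> u v uv; apply: connect1; rewrite /f uv orbT.
(* Each side is connected in [f], so one connection across the cut suffices. *)
have glue e : symmetric e -> (forall x y, connect f x y -> connect e x y) ->
    (exists u v, [/\ u \in A, v \notin A & connect e u v]) ->
    forall x y, connect e x y.
  move=> sye sub [u [v [uA vA uv]]] x y.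
  have H z : connect e u z.
    have [zA|zA] := boolP (z \in A); first by apply/sub/cf; rewrite uA zA.
    by apply: connect_trans uv _; apply/sub/cf; rewrite (negbTE vA) (negbTE zA).
  by apply: connect_trans (H y); rewrite (sym_connect_sym sye).
have cutf : forall x y, x \in A -> y \notin A -> f x y -> false.
  by move=> x y xA yA /(clf _ _ xA); rewrite (negbTE yA).
case: (boolP p) df => Ep df /=.
  pose e x y := f x y || pair_rel a b x y.
  have nab : a != b by apply: contraTneq aA => ->.
  have sye : symmetric e by move=> x y; rewrite /e syf pair_relC.
  exists e; split.
  - split=> // [x|x].
      rewrite /e irf /pair_rel; have [->|] := eqVneq x a => //=.
        by rewrite (negbTE nab).
      by rewrite andbF.
    have -> : nbdeg e x = nbdeg f x + \sum_y (pair_rel a b x y : nat).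
      rewrite !nbdeg_sum -big_split /=; apply: eq_bigr => y _; rewrite /e.
      suff : pair_rel a b x y -> f x y = false.
        by case: pair_rel => [->|_] //; rewrite orbF addn0.
      case/orP=> /andP[/eqP-> /eqP->]; last rewrite syf;
        by apply/negbTE/negP => /(cutf _ _ aA bA).
    rewrite df sum_pair_rel //; have := dh x.
    have [->|_] := eqVneq x a; first by rewrite (negbTE nab) /=; lia.
    by case: (x == b) => /=; lia.
  - apply: (glue e sye).
      by apply: connect_sub => x y fxy; apply: connect1; rewrite /e fxy.
    by exists a, b; split=> //; apply: connect1; rewrite /e /pair_rel !eqxx orbT.
  apply: leq_trans (_ : cut (pair_rel a b) A <= _).
    by apply: leq_cut => x y xA yA /orP[/(cutf _ _ xA yA)|].
  by apply: leq_trans (cut_pair_rel aA bA) _.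
have rf : realizes d f by split=> // x; rewrite df /= subn0.
have [||u [v [uA fuv nb]]] := @nonbridge_exists _ f A syf irf _ clf.
- by apply/set0Pn; exists a.
- by rewrite (eq_bigr d) => [|x _]; [lia|case: rf].
have [y fby] : exists y, f b y.
  have : 0 < nbdeg f b by case: rf => _ _ ->; case/andP: (dh b).
  by case/card_gt0P=> y; rewrite inE; exists y.
have vA := clf _ _ uA fuv.
have yA : y \notin A.
  by apply: contra bA => yA; apply: (clf y b); rewrite // syf.
have far : ~~ connect f u b by apply: contra bA; apply: clfc.
exists (switch f u v b y); split.
- exact: switch_realizes.
- apply: glue; first exact: switch_sym.
    exact: connect_switch.
  by exists u, b; split=> //; apply: connect_switch_ux.
apply: leq_trans (_ : cut (pair_rel u b) A + cut (pair_rel v y) A <= _).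
  apply: leq_trans (cutU _ _ _); apply: leq_cut => z z' zA z'A.
  by case/orP=> // /andP[/andP[/(cutf _ _ zA z'A)]].
exact: leq_add (cut_pair_rel uA bA) (cut_pair_rel vA yA).
Qed.

End TwoHalves.

(** * The spectral gap and cuts *)

From mathcomp Require Import all_order all_algebra.
From mathcomp Require Import reals.
From mathcomp Require Import complex ring lra.
Import Order.TTheory GRing.Theory Num.Theory.

Section Spectrum.
Local Open Scope ring_scope.
Local Open Scope sesquilinear_scope.

(** The determinant of [P], lifted to polynomials, is a nonzero constant and cancels. *)
Lemma char_poly_similar (F : fieldType) n (P A B : 'M[F]_n) :
  P \in unitmx -> P *m A = B *m P -> char_poly A = char_poly B.
Proof.
move=> Pu PAB.
have E : map_mx polyC P *m char_poly_mx A = char_poly_mx B *m map_mx polyC P.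
  rewrite /char_poly_mx mulmxBr mulmxBl -!map_mxM PAB; congr (_ - _).
  by rewrite scalar_mxC.
have : \det (map_mx polyC P) * char_poly A = \det (map_mx polyC P) * char_poly B.
  by rewrite -det_mulmx E det_mulmx mulrC.
apply: mulfI; rewrite det_map_mx polyC_eq0 -unitfE; exact: Pu.
Qed.

Lemma count_le_sorted (R : realDomainType) (s : seq R) (c : R) :
  sorted <=%R s -> c < s`_1 -> (count (fun x : R => x <= c)%R s <= 1)%N.
Proof.
case: s => [|x [|y s]] //=; first by move=> _ _; case: (x <= c).
move=> /andP[_ /order_path_min/allP min] cy; rewrite (leNgt y) cy /= add0n.
rewrite (_ : count _ s = 0%N) ?addn0; first by case: (x <= c).
apply/eqP; rewrite -leqn0 leqNgt -has_count; apply/hasPn => z /min yz.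
by rewrite -ltNge (lt_le_trans cy) // yz // => ? ? ? /le_trans; apply.
Qed.

Section SpectralGap.
Variables (R : realType) (n : nat) (e : rel 'I_n).
Hypotheses (sy : symmetric e) (dpos : forall i, (0 < deg e i)%N).
Local Notation C := R[i].
Local Notation "x %:C" := (real_complex R x) : ring_scope.

Let w i : C := sqrtC (deg e i)%:R.

(* The symmetric matrix D^{1/2} (I - D^{-1} A) D^{-1/2}. *)
Let N : 'M[C]_n := \matrix_(i, j) ((i == j)%:R - (e i j)%:R / (w i * w j)).

Let U := spectralmx N.
Let l := spectral_diag N.

Let w_gt0 i : 0 < w i. Proof. by rewrite sqrtC_gt0 ltr0n. Qed.
Let w_neq0 i : w i != 0. Proof. exact: lt0r_neq0. Qed.
Let ww i : w i * w i = (deg e i)%:R. Proof. by rewrite -expr2 sqrtCK. Qed.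
Let w_conj i : (w i)^* = w i.
Proof. by apply: CrealP; rewrite ger0_real // ltW. Qed.

Let N_herm : N \is hermsymmx.
Proof.
apply: realsym_hermsym.
  apply/is_hermitianmxP; rewrite expr0 scale1r; apply/matrixP=> i j.
  by rewrite !mxE eq_sym sy (mulrC (w j)).
apply/mxOverP=> i j; rewrite !mxE rpredB ?rpred_nat // rpred_div ?rpred_nat //.
by rewrite rpredM // ger0_real // ltW.
Qed.

Let Uu : U \is unitarymx. Proof. exact: spectral_unitarymx. Qed.

Let UN : U *m N = diag_mx l *m U.
Proof.
have /orthomx_spectralP E := hermitian_normalmx N_herm.
by rewrite {1}E -mulmxA mulKVmx ?spectral_unit.
Qed.

Let ev i : R := complex.Re (l 0 i).

Let evE i : l 0 i = (ev i)%:C.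
Proof.
by rewrite RRe_real //; have /mxOverP := hermitian_spectral_diag_real N_herm; apply.
Qed.

(** Conjugation by the square roots of the degrees takes [negLap] to [N], which [U] diagonalizes;
    the identity is checked after embedding [R] into [R[i]]. *)
Lemma char_poly_negLap : char_poly (negLap R e) = \prod_i ('X - (ev i)%:P).
Proof.
apply: (@map_poly_inj _ _ (real_complex R)); rewrite map_char_poly.
pose P : 'M[C]_n := diag_mx (\row_i w i).
have Pu : P \in unitmx.
  rewrite unitmxE det_diag unitfE; apply/prodf_neq0 => i _; by rewrite mxE.
rewrite (@char_poly_similar _ _ (U *m P) _ (diag_mx l)).
- rewrite char_poly_trig ?diag_mx_is_trig // rmorph_prod; apply: eq_bigr => i _.
  by rewrite mxE eqxx mulr1n evE rmorphB /= map_polyX map_polyC.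
- by rewrite unitmx_mul spectral_unit.
rewrite mulmxA -UN -!mulmxA; congr mulmx.
apply/matrixP=> i j; rewrite /P mul_diag_mx mul_mx_diag !mxE.
rewrite rmorphB fmorph_div /= !rmorph_nat.
rewrite mulrBr mulrBl; congr (_ - _).
  by case: eqVneq => [->|]; rewrite ?mul1r ?mulr1 ?mul0r ?mulr0.
rewrite -ww; field; by rewrite !w_neq0.
Qed.

(** Here [y] holds the coordinates of [x] in the orthonormal eigenbasis formed by the rows of
    [U]. *)
Lemma quadratic_form (x : 'rV[C]_n) (y := x *m U^t*) :
  \sum_i \sum_j x 0 i * N i j * (x 0 j)^* = \sum_i l 0 i * `|y 0 i| ^+ 2.
Proof.
have xE : x = y *m U by rewrite /y mulmxKtV.
have -> : \sum_i \sum_j x 0 i * N i j * (x 0 j)^* = (x *m N *m x^t*) 0 0.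
  rewrite mxE exchange_big; apply: eq_bigr => j _.
  rewrite mxE big_distrl; apply: eq_bigr => i _ /=.
  by rewrite !mxE.
have -> : x *m N *m x^t* = y *m diag_mx l *m y^t*.
  rewrite {1}xE -[y *m U *m N]mulmxA UN -!mulmxA; do 2!congr mulmx.
  by rewrite /y trmx_mul map_mxM trmxCK.
rewrite mxE; apply: eq_bigr => i _.
by rewrite mul_mx_diag !mxE normCK; ring.
Qed.

Lemma norm_coordinates (x : 'rV[C]_n) (y := x *m U^t*) :
  \sum_i `|x 0 i| ^+ 2 = \sum_i `|y 0 i| ^+ 2.
Proof.
have E (z : 'rV[C]_n) : \sum_i `|z 0 i| ^+ 2 = (z *m z^t*) 0 0.
  by rewrite mxE; apply: eq_bigr => i _; rewrite !mxE normCK.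
rewrite !E /y trmx_mul map_mxM trmxCK mulmxA -(mulmxA x).
by rewrite -invmx_unitary // mulVmx ?spectral_unit // mulmx1.
Qed.

(** * Test vectors constant on the two sides of a cut *)

Variable A : {set 'I_n}.
Hypotheses (A0 : A != set0) (B0 : ~: A != set0).
Local Notation vA := (\sum_(i in A) deg e i)%N.
Local Notation vB := (\sum_(i in ~: A) deg e i)%N.

Let step (a b : C) i : C := if i \in A then a else b.

(** The weights [w] turn the form of [N] into the Laplacian form of the step function. Edges inside
    a side contribute nothing, and the two directions of a crossing edge add up to the squared
    difference. *)
Lemma step_form (a b : C) :
  let x : 'rV[C]_n := \row_i (step a b i * w i) in
  \sum_i \sum_j x 0 i * N i j * (x 0 j)^* = (cut e A)%:R * `|a - b| ^+ 2.
Proof.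
move=> x; pose f := step a b.
have -> : \sum_i \sum_j x 0 i * N i j * (x 0 j)^* =
    \sum_i \sum_j (e i j)%:R * (f i * (f i)^* - f i * (f j)^*).
  apply: eq_bigr => i _.
  have -> : \sum_j (e i j)%:R * (f i * (f i)^* - f i * (f j)^*) =
      f i * (f i)^* * (w i * w i) - \sum_j (e i j)%:R * (f i * (f j)^*).
    rewrite ww [deg _ _]nbdeg_sum natr_sum big_distrr -sumrB /=.
    by apply: eq_bigr => j _; ring.
  have -> : f i * (f i)^* * (w i * w i) =
      \sum_j (i == j)%:R * (f i * (f j)^* * (w i * w j)).
    rewrite (bigD1 i) //= eqxx mul1r big1 ?addr0 // => j.
    by rewrite eq_sym => /negbTE ->; rewrite mul0r.
  rewrite -sumrB; apply: eq_bigr => j _; rewrite /x !mxE rmorphM /= w_conj -!/(f _).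
  by field; rewrite !w_neq0.
rewrite (bigID (mem A)) /=.
have -> : \sum_(i in A) \sum_j (e i j)%:R * (f i * (f i)^* - f i * (f j)^*) =
    (cut e A)%:R * (a * a^* - a * b^*).
  rewrite natr_sum big_distrl; apply: eq_bigr => i iA /=.
  rewrite natr_sum big_distrl (bigID (mem A)) /= big1 ?add0r.
    apply: eq_big => [j|j jA]; first by rewrite inE.
    by rewrite /f /step iA (negbTE jA).
  by move=> j jA; rewrite /f /step iA jA subrr mulr0.
have -> : \sum_(i | i \notin A) \sum_j (e i j)%:R * (f i * (f i)^* - f i * (f j)^*) =
    (cut e A)%:R * (b * b^* - b * a^*).
  rewrite [cut e A]exchange_big natr_sum big_distrl /=.
  apply: eq_big => [j|i iA]; first by rewrite inE.
  rewrite natr_sum big_distrl (bigID (mem A)) /= [X in _ + X]big1 ?addr0.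
    apply: eq_bigr => j jA.
    by rewrite /f /step jA (negbTE iA) sy.
  by move=> j jA; rewrite /f /step (negbTE iA) (negbTE jA) subrr mulr0.
by rewrite normCK rmorphB /=; ring.
Qed.

Lemma step_norm (a b : C) :
  \sum_i `|(\row_i (step a b i * w i) : 'rV[C]_n) 0 i| ^+ 2 =
    vA%:R * `|a| ^+ 2 + vB%:R * `|b| ^+ 2.
Proof.
rewrite (bigID (mem A)) /= !natr_sum !big_distrl /=; congr (_ + _).
  apply: eq_bigr => i iA; rewrite mxE /step iA normrM exprMn mulrC.
  by rewrite (gtr0_norm (w_gt0 i)) expr2 ww.
apply: eq_big => [i|i iA]; first by rewrite inE.
rewrite mxE /step (negbTE iA) normrM exprMn mulrC.
by rewrite (gtr0_norm (w_gt0 i)) expr2 ww.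
Qed.

Lemma step_form_le (a b : C) (c : R) :
    (cut e A * (vA + vB))%N%:R <= c * (vA * vB)%N%:R ->
  (cut e A)%:R * `|a - b| ^+ 2 <= c%:C * (vA%:R * `|a| ^+ 2 + vB%:R * `|b| ^+ 2).
Proof.
move=> hc.
have vpos (B : {set 'I_n}) : B != set0 -> (0 < \sum_(i in B) deg e i)%N.
  case/set0Pn=> i iB; rewrite (bigD1 i) //=; exact: ltn_addr.
have vA0 : 0 < vA%:R :> C by rewrite ltr0n vpos.
have vB0 : 0 < vB%:R :> C by rewrite ltr0n vpos.
set W := (X in _ <= _ * X).
have W0 : 0 <= W by rewrite addr_ge0 // mulr_ge0 ?exprn_ge0 ?ler0n.
(* The difference of the two sides is the square of the modulus of [vA * a + vB * b]. *)
have CS : vA%:R * vB%:R * `|a - b| ^+ 2 <= (vA%:R + vB%:R) * W.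
  rewrite -subr_ge0 (_ : _ - _ = `|vA%:R * a + vB%:R * b| ^+ 2) ?exprn_ge0 //.
  by rewrite /W !normCK rmorphB rmorphD !rmorphM /= !rmorph_nat; ring.
rewrite -(ler_pM2l (mulr_gt0 vA0 vB0)) mulrCA.
apply: le_trans (ler_wpM2l (ler0n _ _) CS) _.
rewrite !mulrA ler_wpM2r // -natrD -natrM.
have := hc; rewrite -lecR (rmorphM (real_complex R)) /= !(rmorph_nat (real_complex R)) => /le_trans; apply.
by rewrite natrM mulrC.
Qed.

(* Courant-Fischer on the two-dimensional space of functions constant on A and on
   its complement: it meets the orthogonal of any given eigenvector. *)
Lemma lambda1_le_cut (c : R) :
    (cut e A * (vA + vB))%N%:R <= c * (vA * vB)%N%:R -> lambda1_le e c.
Proof.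
move=> hc; pose s := sort <=%R [seq ev i | i <- enum 'I_n].
exists s; split.
  split; first exact: sort_le_sorted.
  rewrite char_poly_negLap (perm_big _ (permEl (perm_sort _ _))) big_map.
  by rewrite big_enum.
rewrite leNgt; apply/negP=> /(count_le_sorted (sort_le_sorted _)).
rewrite (permP (permEl (perm_sort _ _))) count_map => cnt.
(* At most one eigenvalue is at most [c]; [i0] is its index, or any index if there is none. *)
have [i0 i0P] : exists i0, forall i, i != i0 -> c < ev i.
  have {}cnt : (#|[set i | (ev i <= c)%R]| <= 1)%N.
    by move: cnt; rewrite -sum1_count big_enum_cond /= sum1dep_card.
  have [E|[i1 i1P]] := set_0Vmem [set i | ev i <= c].
    have [i _] := set0Pn _ A0; exists i => j _.
    by rewrite ltNge; apply/negP => le; move/setP/(_ j): E; rewrite !inE le.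
  exists i1 => j ne; rewrite ltNge; apply: contra ne => le.
  by rewrite (card_le1_eqP cnt j i1) // inE.
(* Making [x] orthogonal to the eigenvector [i0] is one linear equation in [a] and [b], so it has a
   nonzero solution. *)
pose p := \sum_(i in A) w i * (U i0 i)^*; pose q := \sum_(i in ~: A) w i * (U i0 i)^*.
have [a [b [ab0 abE]]] : exists a b : C, (a != 0) || (b != 0) /\ a * p + b * q = 0.
  have [q0|q0] := eqVneq q 0.
    have [p0|p0] := eqVneq p 0; last by exists 0, 1; rewrite oner_eq0 orbT q0; split=> //; ring.
    by exists 1, 0; rewrite oner_eq0 p0; split=> //; ring.
  by exists q, (- p); rewrite q0; split=> //; ring.
pose x : 'rV[C]_n := \row_i (step a b i * w i); pose y := x *m U^t*.
have y0 : y 0 i0 = 0.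
  rewrite -abE mxE (bigID (mem A)) /= !big_distrr /=; congr (_ + _).
    by apply: eq_bigr => i iA; rewrite !mxE /step iA mulrA.
  apply: eq_big => [i|i iA]; first by rewrite inE.
  by rewrite !mxE /step (negbTE iA) mulrA.
(* The Rayleigh quotient of [x] is at most [c], yet every eigenvalue other than [i0] exceeds [c]; so
   all coordinates of [x] vanish. *)
have := step_form_le a b hc; rewrite -step_form -step_norm -/x.
rewrite quadratic_form norm_coordinates -/y => le.
have ge0 i : 0 <= (l 0 i - c%:C) * `|y 0 i| ^+ 2.
  have [->|ne] := eqVneq i i0; first by rewrite y0 normr0 expr0n mulr0.
  by rewrite mulr_ge0 ?exprn_ge0 // subr_ge0 evE lecR ltW ?i0P.
have sum0 : \sum_i (l 0 i - c%:C) * `|y 0 i| ^+ 2 = 0.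
  apply/eqP; rewrite eq_le sumr_ge0 ?andbT //.
  under eq_bigr do rewrite mulrBl.
  by rewrite sumrB -big_distrr /= subr_le0.
have yE i : y 0 i = 0.
  have [->//|ne] := eqVneq i i0.
  have /eqP := psumr_eq0P (fun i _ => ge0 i) sum0 (i := i) isT.
  rewrite mulf_eq0 subr_eq0 evE sqrf_eq0 normr_eq0 => /orP[/eqP|/eqP//].
  by move/complexI => E; have := i0P i ne; rewrite E ltxx.
have xE : x = 0.
  have -> : x = y *m U by rewrite /y mulmxKtV.
  rewrite (_ : y = 0) ?mul0mx //; by apply/rowP=> i; rewrite yE mxE.
have [i iA] := set0Pn _ A0; have [j jA] := set0Pn _ B0.
have /rowP/(_ i) := xE; have /rowP/(_ j) := xE; move: jA; rewrite !mxE /step iA inE.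
move=> /negbTE -> /eqP; rewrite mulf_eq0 (negbTE (w_neq0 j)) orbF => b0 /eqP.
by rewrite mulf_eq0 (negbTE (w_neq0 i)) orbF => a0; move: ab0; rewrite a0 b0.
Qed.

End SpectralGap.

End Spectrum.

(** * The alternating split *)

Lemma handshake (n : nat) (e : rel 'I_n) : symmetric e -> irreflexive e ->
  \sum_i deg e i = (2 * nedges e)%N.
Proof.
move=> sy ir; rewrite (eq_bigr _ (fun i _ => nbdeg_sum e i)) pair_bigA /=.
rewrite (bigID (fun p : 'I_n * 'I_n => p.1 < p.2)) /=.
have E1 : \sum_(p : 'I_n * 'I_n | p.1 < p.2) (e p.1 p.2 : nat) = nedges e.
  rewrite /nedges -sum1dep_card big_mkcondr /=.
  by apply: eq_bigr => p _; case: (e _ _).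
rewrite E1 mul2n -addnn; congr addn; rewrite -E1.
rewrite (reindex_inj (h := fun p : 'I_n * 'I_n => (p.2, p.1))) /=; last first.
  by move=> [i j] [i' j'] [-> ->].
rewrite (bigID (fun p : 'I_n * 'I_n => p.1 < p.2)) /= [X in addn _ X]big1.
  rewrite addn0; apply: eq_big => [[i j]|[i j] _] /=; last by rewrite sy.
  by rewrite -leqNgt; case: ltngtP.
case=> i j /=; rewrite -!leqNgt -eqn_leq => /eqP/val_inj ->.
by rewrite ir.
Qed.

(** Adding a head swaps the two parities: the new even sum is the head plus the old odd sum, and the
    new odd sum is the old even sum. *)
Lemma alternating_sum (s : seq nat) : sorted geq s ->
  (\sum_(i < size s | odd i) nth 0 s i <= \sum_(i < size s | ~~ odd i) nth 0 s i
    <= \sum_(i < size s | odd i) nth 0 s i + head 0 s)%N.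
Proof.
elim: s => [|x s IH] /=; first by rewrite !big_ord0.
move=> xs; have le : (head 0 s <= x)%N by case: s xs {IH} => //= y s /andP[].
have recl (P : pred nat) : \sum_(i < (size s).+1 | P i) nth 0 (x :: s) i =
    ((if P 0 then x else 0) + \sum_(i < size s | P i.+1) nth 0 s i)%N.
  by rewrite big_mkcond big_ord_recl /= -big_mkcond.
have {IH} := IH (path_sorted xs); rewrite (recl odd) (recl (fun i => ~~ odd i)) /=.
under [X in (_ -> _ <= _ + X <= _)%N]eq_bigl do rewrite negbK.
by lia.
Qed.

Lemma alternating_card n :
  (#|[set i : 'I_n | odd i]| <= #|[set i : 'I_n | ~~ odd i]|
    <= #|[set i : 'I_n | odd i]|.+1)%N.
Proof.
have srt : sorted geq (nseq n 1) by elim: n => // -[].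
have := alternating_sum srt; rewrite size_nseq.
have one (i : 'I_n) : nth 0 (nseq n 1) i = 1 by rewrite nth_nseq ltn_ord.
rewrite !(eq_bigr (fun=> 1) (fun i _ => one i)) !sum1dep_card.
by case: (n) => [|m] /=; lia.
Qed.

(** Equal values are consecutive in a sorted list; two neighbouring positions have opposite parity,
    so both halves receive the value. *)
Lemma adjacent_of_count (s : seq nat) k : sorted geq s -> (1 < count_mem k s)%N ->
  exists i, [/\ (i.+1 < size s)%N, nth 0 s i = k & nth 0 s i.+1 = k].
Proof.
elim: s => //= x s IH xs; have [xk|ne] := eqVneq x k; last first.
  rewrite add0n => /(IH (path_sorted xs))[i [lt E E']].
  by exists i.+1.
subst k; rewrite add1n ltnS -has_count => /hasP[z zs /eqP zk]; rewrite {}zk in zs.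
exists 0; split=> //; first by case: s zs {IH xs}.
case: s zs xs {IH} => //= y s; rewrite inE => /predU1P[->//|zs] /andP[xy ys].
have /allP/(_ _ zs) yk := order_path_min (rev_trans leq_trans) ys.
by apply/eqP; rewrite eqn_leq xy.
Qed.

Theorem theorem3 (R : realType) (pi : seq nat) :
  graphic pi ->
  full_seq pi ->
  sorted geq pi ->
  (forall d, d \in pi -> 1 <= d <= dmax pi)%N ->
  (4 * dmax pi <= size pi)%N ->
  (2 * size pi + dmax pi <= sumn pi)%N ->
  (forall k, 1 <= k <= dmax pi -> 1 < count_mem k pi)%N ->
  exists e : rel 'I_(size pi),
    realization pi e /\ connected_graph e /\
    lambda1_le e ((4 : R) / ((nedges e)%:R - (dmax pi)%:R / 2)).
Proof.
move=> _ [_ even_sum] srt range size4 sum2 mult.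
set h := dmax pi in range size4 sum2 mult *.
have [pi0|n0] := posnP (size pi).
  have no (i : 'I_(size pi)) : False by case: i => i; rewrite pi0.
  exists (fun _ _ => false); split; first by split=> [|i]; [split|case: (no i)].
  split=> [i|]; first by case: (no i).
  have -> : h = 0%N by lia.
  exists [::]; split; last by rewrite mul0r subr0 divr_ge0.
  split=> //; rewrite big_nil.
  by move: (negLap _ _); rewrite pi0 => M; rewrite /char_poly det_mx00.
pose d (i : 'I_(size pi)) := nth 0%N pi i.
pose A := [set i : 'I_(size pi) | ~~ odd i].
have dh i : (0 < d i <= h)%N by apply/range/mem_nth.
have sumd : (\sum_i d i)%N = sumn pi by rewrite sumnE (big_nth 0%N) big_mkord.
have le_sum : (sumn pi <= size pi * h)%N.
  rewrite -sumd -[X in (X * _)%N]card_ord -sum_nat_const; apply: leq_sum => i _.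
  by case/andP: (dh i).
(* With [h] at most 1 the sum would be at most [size pi], below [2 * size pi]. *)
have h1 : (1 < h)%N by move: n0 sum2 le_sum; case: (h) => [|[|]] //; lia.
have values k : (0 < k <= h)%N ->
    exists i j, [/\ i \in A, j \in ~: A, d i = k & d j = k].
  move=> /mult/(adjacent_of_count srt)[i [lt E E']].
  pose i1 := Ordinal (ltnW lt); pose i2 := Ordinal lt.
  by case: (boolP (odd i)) => oi; [exists i2, i1|exists i1, i2];
    rewrite !inE /= oi.
have volA : (\sum_(i in A) d i = \sum_(i < size pi | ~~ odd i) nth 0 pi i)%N.
  by apply: eq_bigl => i; rewrite inE.
have volB : (\sum_(i in ~: A) d i = \sum_(i < size pi | odd i) nth 0 pi i)%N.
  by apply: eq_bigl => i; rewrite !inE negbK.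
have vol_split (f : 'I_(size pi) -> nat) :
    (\sum_i f i = \sum_(i in A) f i + \sum_(i in ~: A) f i)%N.
  by rewrite (bigID (mem A)) /=; congr addn; apply: eq_bigl => i; rewrite in_setC.
have headh : (head 0 pi <= h)%N.
  by have := dh (Ordinal n0); rewrite /d /= nth0 => /andP[].
have := alternating_sum srt; rewrite -volA -volB => /andP[AB1 AB2].
have AB : (\sum_(i in A) d i + \sum_(i in ~: A) d i)%N = sumn pi.
  by rewrite -vol_split.
have cAB : (#|A| + #|~: A|)%N = size pi by rewrite cardsC card_ord.
have [cA1 cA2] : (#|~: A| <= #|A|)%N /\ (#|A| <= #|~: A|.+1)%N.
  have -> : ~: A = [set i : 'I_(size pi) | odd i] by apply/setP=> i; rewrite !inE negbK.
  by have /andP[] := alternating_card (size pi).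
(* The sizes differ by at most 1 and [4 * h <= size pi], so each side has at least [2 * h] vertices.
   The volumes differ by at most [h], which the surplus [dmax pi] in [sum2] absorbs. *)
have [|||||||e [[sy ir de] con cut2]] := @two_halves_realization _ d h A h1 dh.
- by move=> k /values[i [_ [? _ ? _]]]; exists i.
- by move=> k /values[_ [i [_ ? _ ?]]]; exists i.
- by lia.
- by lia.
- by lia.
- by lia.
- by rewrite sumd.
have degE i : deg e i = d i by exact: de.
exists e; split; first by split.
split; first exact: con.
have [iA [iB [iAP iBP _ _]]] := values 1%N (ltnW h1).
apply: (@lambda1_le_cut R _ e sy _ A).
- by move=> i; rewrite degE; case/andP: (dh i).
- by apply/set0Pn; exists iA.
- by apply/set0Pn; exists iB.
rewrite !(eq_bigr _ (fun i _ => degE i)).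
have := handshake sy ir; rewrite (eq_bigr _ (fun i _ => degE i)) vol_split.
set vA := (\sum_(i in A) d i)%N in AB AB1 AB2 *.
set vB := (\sum_(i in ~: A) d i)%N in AB AB1 AB2 *.
set m := nedges e; move=> Em.
(* The target with denominators cleared. As [vA + vB] is [2 * m] and [vA <= vB + h], the factor
   [2 * m - h] is at most [2 * vB]; then [vB <= vA] bounds [vA + vB] by [2 * vA]. *)
have key : (cut e A * (vA + vB) * (2 * m - h) <= 8 * (vA * vB))%N.
  apply: leq_trans (_ : 2 * (vA + vB) * (2 * m - h) <= _)%N; first by rewrite !leq_mul.
  rewrite -Em; apply: leq_trans (_ : 2 * (vA + vB) * (2 * vB) <= _)%N.
    by rewrite leq_mul //; lia.
  have /subnK <- := AB1; move: (vA - vB)%N => t; nia.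
have hm : (h < 2 * m)%N by lia.
have mh : (0 < m%:R - h%:R / 2 :> R)%R.
  by move: hm; rewrite -(ltr_nat R) natrM; lra.
rewrite mulrAC ler_pdivlMr //.
move: key; rewrite -(ler_nat R) !(natrM _ 8) [X in (X <= _)%R]natrM natrB ?(ltnW hm) //.
by rewrite natrM; lra.
Qed.
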